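(* There exists an absolute constant $C>0$ such that the following holds for every integer $n\ge 1$, every reference probability distribution $\mathbf{q}$ over $[n]$ and every $0<\varepsilon\le 1$. There is an algorithm which, given the full description of $\mathbf{q}$, the parameter $\varepsilon$, and at most $C\,\frac{\log^2 n}{\varepsilon^4}$ i.i.d. samples from an unknown distribution $\mathbf{p}\in\Pi_n(\mathbf{q})$, distinguishes with probability at least $2/3$ between (i) $\mathbf{p}=\mathbf{q}$ and (ii) $d_{\mathrm{TV}}(\mathbf{p},\mathbf{q})>\varepsilon$.
   Context: $[n]=\{1,\dots,n\}$, $\mathcal{S}_n$ is the set of permutations of $[n]$, and a probability distribution over $[n]$ is identified with its probability mass function $[n]\to[0,1]$. Logarithms are to base 2. For a distribution $\mathbf{q}$ over $[n]$, $\Pi_n(\mathbf{q})=\{\mathbf{q}\circ\pi : \pi\in\mathcal{S}_n\}$ is the set of distributions equal to $\mathbf{q}$ up to a permutation of the domain. The total variation distance is $d_{\mathrm{TV}}(\mathbf{p},\mathbf{q})=\sup_{S\subseteq[n]}(\mathbf{p}(S)-\mathbf{q}(S))=\frac12\sum_{i=1}^n|\mathbf{p}(i)-\mathbf{q}(i)|$. An algorithm using $s$ samples is a (possibly randomized) map from $[n]^s$ to $\{\mathsf{yes},\mathsf{no}\}$, applied to $s$ i.i.d. samples from $\mathbf{p}$; it may depend on $n$, $\mathbf{q}$ and the parameters but not on $\mathbf{p}$. It distinguishes between (i) and (ii) with probability at least $2/3$ if, for every $\mathbf{p}\in\Pi_n(\mathbf{q})$ satisfying (i), it outputs $\mathsf{yes}$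 with probability at least $2/3$, and for every $\mathbf{p}\in\Pi_n(\mathbf{q})$ satisfying (ii), it outputs $\mathsf{no}$ with probability at least $2/3$ (probability over the samples and the internal randomness); no requirement is made for other $\mathbf{p}$. *)

(* Defs.v *)
From HB Require Import structures.
From mathcomp Require Import all_boot all_order all_algebra perm.
From mathcomp Require Import classical_sets reals exp.

Set Implicit Arguments.
Unset Strict Implicit.
Unset Printing Implicit Defensive.

Import Order.TTheory GRing.Theory Num.Theory.

Local Open Scope ring_scope.

Definition is_pmf (R : realType) (T : finType) (f : {ffun T -> R}) : bool :=
  [forall x, 0 <= f x] && (\sum_x f x == 1).

(* Being a boolean subtype, [distr R T] has Leibniz equality equivalent to
   pointwise equality of the probability mass functions. *)
Record distr (R : realType) (T : finType) := Distr {
  pmf :> {ffun T -> R};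
  pmfP : is_pmf pmf
}.

HB.instance Definition _ (R : realType) (T : finType) :=
  [isSub for @pmf R T].
HB.instance Definition _ (R : realType) (T : finType) :=
  [Equality of distr R T by <:].

Definition prob (R : realType) (T : finType) (p : distr R T) (S : {set T}) : R :=
  \sum_(x in S) p x.

Definition dTV (R : realType) (T : finType) (p q : distr R T) : R :=
  sup [set prob p S - prob q S | S in [set: {set T}]]%classic.

Lemma dTVE (R : realType) (T : finType) (p q : distr R T) :
  dTV p q = 2^-1 * \sum_x `|p x - q x|.
Proof.
have sum1 (r : distr R T) : \sum_x r x = 1.
  by have /andP[_ /eqP] := pmfP r.
have diffE S : prob p S - prob q S = \sum_(x in S) (p x - q x).
  by rewrite /prob sumrB.
pose P := [set x | q x <= p x]; pose a := prob p P - prob q P.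
have diff_le S : prob p S - prob q S <= a.
  rewrite /a !diffE (big_mkcond (mem S)) (big_mkcond (mem P)).
  apply: ler_sum => x _; rewrite /= inE; case: (leP (q x) (p x)) => h.
    by case: ifP; rewrite ?subr_ge0.
  by case: ifP; rewrite // subr_le0 ltW.
have -> : dTV p q = a.
  apply/eqP; rewrite eq_le; apply/andP; split.
    apply: ge_sup; first by exists a; exists P.
    by move=> _ [S _ <-]; exact: diff_le.
  apply: ub_le_sup; last by exists P.
  by exists a => _ [S _ <-]; exact: diff_le.
have sum0 : \sum_x (p x - q x) = 0 by rewrite sumrB !sum1 subrr.
have -> : \sum_x `|p x - q x| = a *+ 2.
  transitivity (\sum_x (`|p x - q x| + (p x - q x))).
    by rewrite big_split /= sum0 addr0.
  rewrite /a diffE (big_mkcond (mem P)) /= -sumrMnl.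
  apply: eq_bigr => x _; rewrite inE.
  case: (leP (q x) (p x)) => h; first by rewrite ger0_norm ?subr_ge0.
  by rewrite ltr0_norm ?subr_lt0// addNr mul0rn.
by rewrite -[a *+ 2]mulr_natl mulKf// pnatr_eq0.
Qed.

Definition Pi (R : realType) (n : nat) (q : distr R 'I_n) : set (distr R 'I_n) :=
  [set p | exists pi : 'S_n, forall i, p i = q (pi i)]%classic.

Definition yes : bool := true.
Definition no : bool := false.

(* A randomized map from [n]^s to {yes, no}, as a stochastic kernel: the
   internal randomness is recorded through the law of the answer on each
   input.  A deterministic algorithm is one whose laws are point masses. *)
Definition algorithm (R : realType) (n s : nat) : Type :=
  {ffun 'I_s -> 'I_n} -> distr R bool.

(* Probability that [A] outputs [b] on s i.i.d. samples from [p], over both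
   the samples and the internal randomness. *)
Definition prob_output (R : realType) (n s : nat) (A : algorithm R n s)
    (p : distr R 'I_n) (b : bool) : R :=
  \sum_(x : {ffun 'I_s -> 'I_n}) (\prod_(i < s) p (x i)) * A x b.

Definition distinguishes (R : realType) (n s : nat) (A : algorithm R n s)
    (D : set (distr R 'I_n)) (case1 case2 : distr R 'I_n -> Prop) : Prop :=
  forall p, D p ->
    (case1 p -> 2 / 3 <= prob_output A p yes) /\
    (case2 p -> 2 / 3 <= prob_output A p no).

Definition log2 (R : realType) (x : R) : R := ln x / ln 2.

(* Main.v *)
Require Import Defs.
From mathcomp Require Import all_boot all_order all_algebra perm.
From mathcomp Require Import classical_sets reals exp.
From mathcomp Require Import ring lra.

(** A permutation p of q has the same entropy as q.  Hence
      E_q [ln q] - E_p [ln q] = E_p [ln p] - E_p [ln q] = KL(p || q),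
    and by a Pinsker-type inequality this gap is at least of order dTV(p, q)^2.
    So the mean of the single statistic ln q(X) separates p = q from any
    permutation p with dTV(p, q) > eps, with a gap of order eps^2.

    Since ln q can be arbitrarily negative, or undefined, q is first shifted:
    with w(i) = q(i) + 1/n, the function w and the same shift of p are still
    permutations of each other, their difference is still q - p, and
    |ln w| <= ln n as soon as n >= 2.  This gives the gap dTV(p, q)^2 / 2
    (permutation_entropy_gap, resting on sqr_sum_norm_le_entropy).

    The tester compares the empirical mean of ln w(X) with
    E_q [ln w] - eps^2 / 4, the middle of the gap.  The statistic has variance
    at most (ln n)^2, so by Chebyshev's inequality (prob_output_ge_chebyshev)
    the probability of error on s samples is at most
    (ln n)^2 / (s (eps^2 / 4)^2), which is at most 1/3 once
    s >= 48 (ln n)^2 / eps^4. *)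

Set Implicit Arguments.
Unset Strict Implicit.
Unset Printing Implicit Defensive.

Import Order.TTheory GRing.Theory Num.Theory.

Local Open Scope ring_scope.

(** * The relative entropy between a distribution and its permutation *)

Lemma pmf_sum1 (R : realType) (T : finType) (p : distr R T) : \sum_x p x = 1.
Proof. by have /andP[_ /eqP] := pmfP p. Qed.

Lemma pmf_ge0 (R : realType) (T : finType) (p : distr R T) x : 0 <= p x.
Proof. by have /andP[/forallP h _] := pmfP p; exact: h. Qed.

(** With u and v the square roots of a and b, this is ln (v / u) <= v / u - 1
    multiplied by 2 u^2.  The terms - a + b cancel when summed over functions
    of equal total mass, so that the relative entropy dominates the squared
    Hellinger distance. *)
Lemma sqr_hellinger_le_ln_ratio (R : realType) (a b : R) : 0 < a -> 0 < b ->
  (Num.sqrt a - Num.sqrt b) ^+ 2 <= a * (ln a - ln b) - a + b.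
Proof.
move=> a0 b0.
have [u0 v0] : 0 < Num.sqrt a /\ 0 < Num.sqrt b by rewrite !sqrtr_gt0.
rewrite -{2 3 4}(sqr_sqrtr (ltW a0)) -{2 3}(sqr_sqrtr (ltW b0)).
set u := Num.sqrt a in u0 *; set v := Num.sqrt b in v0 *.
rewrite !lnXn // !mulr2n.
have : ln v - ln u <= v / u - 1.
  rewrite -ln_div ?posrE // -{1}[v / u](subrK 1) addrC.
  by apply: le_ln1Dx; rewrite ltrBDr addNr divr_gt0.
move/(ler_wpM2l (ltW (mulr_gt0 u0 u0))).
have -> : u * u * (v / u - 1) = u * v - u * u by field; rewrite gt_eqF.
by lra.
Qed.

(** Factor a - b through the square roots and apply 2 X Y <= X^2 + Y^2 to
    X = c |sqrt a - sqrt b| and Y = d (sqrt a + sqrt b).  Summing this over the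
    domain and then choosing c and d replaces the Cauchy-Schwarz inequality in
    the comparison of the l1 and Hellinger distances. *)
Lemma norm_sub_le_ln_ratio (R : realType) (a b c d : R) : 0 < a -> 0 < b ->
  2 * (c * d) * `|a - b| <=
    c ^+ 2 * (a * (ln a - ln b) - a + b) + d ^+ 2 * (2 * (a + b)).
Proof.
move=> a0 b0.
have := ler_wpM2l (sqr_ge0 c) (sqr_hellinger_le_ln_ratio a0 b0).
rewrite -(lerD2r (d ^+ 2 * (2 * (a + b)))); apply: le_trans.
have [u0 v0] := (sqrtr_ge0 a, sqrtr_ge0 b).
rewrite -[X in _ * `|X - _|](sqr_sqrtr (ltW a0)).
rewrite -[X in _ * `|_ - X|](sqr_sqrtr (ltW b0)).
rewrite -[X in 2 * (X + _)](sqr_sqrtr (ltW a0)).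
rewrite -[X in 2 * (_ + X)](sqr_sqrtr (ltW b0)).
set u := Num.sqrt a in u0 *; set v := Num.sqrt b in v0 *.
rewrite subr_sqr normrM (ger0_norm (addr_ge0 u0 v0)).
rewrite -[(u - v) ^+ 2]real_normK ?num_real //.
have /(ler_wpM2l (sqr_ge0 d)) : (u + v) ^+ 2 <= 2 * (u ^+ 2 + v ^+ 2).
  by have := sqr_ge0 (u - v); lra.
by have := sqr_ge0 (c * `|u - v| - d * (u + v)); lra.
Qed.

(** Pinsker's inequality, up to the constant, for positive functions of equal
    total mass M. *)
Lemma sqr_sum_norm_le_entropy (R : realType) (T : finType) (a b : T -> R) (M : R) :
  (forall x, 0 < a x) -> (forall x, 0 < b x) ->
  \sum_x a x = M -> \sum_x b x = M ->
  (\sum_x `|a x - b x|) ^+ 2 <= 4 * M * \sum_x a x * (ln (a x) - ln (b x)).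
Proof.
move=> a0 b0 aM bM.
have agm c d : 2 * (c * d) * (\sum_x `|a x - b x|) <=
    c ^+ 2 * (\sum_x a x * (ln (a x) - ln (b x))) + d ^+ 2 * (4 * M).
  have -> : 4 * M = \sum_x (2 * (a x + b x)).
    by rewrite -mulr_sumr big_split /= aM bM; ring.
  have -> : \sum_x a x * (ln (a x) - ln (b x)) =
      \sum_x (a x * (ln (a x) - ln (b x)) - a x + b x).
    by rewrite big_split sumrB /= aM bM subrK.
  rewrite !mulr_sumr -big_split /=; apply: ler_sum => x _.
  exact: norm_sub_le_ln_ratio.
have L0 : 0 <= \sum_x `|a x - b x| by exact: sumr_ge0.
have M0 : 0 <= M by rewrite -aM; apply: sumr_ge0 => x _; exact: ltW.
have LM : \sum_x `|a x - b x| <= 2 * M.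
  rewrite [2 * M]mulr_natl mulr2n -{1}aM -bM -big_split /=; apply: ler_sum => x _.
  by rewrite (le_trans (ler_normB _ _)) // !gtr0_norm.
move: (\sum_x `|a x - b x|) (\sum_x a x * _) agm L0 LM => L K agm L0 LM.
move: M0; rewrite le_eqVlt => /predU1P[M0|M0].
  have -> : L = 0 by apply/eqP; rewrite eq_le L0 andbT (le_trans LM) // -M0 mulr0.
  by rewrite -M0 mulr0 mul0r expr0n.
have := M0; move=> /ler_pM2l <-.
(* c = 4 M and d = L balance the two terms of agm. *)
by have := agm (4 * M) L; lra.
Qed.

(** The difference of the means of ln w is the relative entropy between the
    shifted distributions, because reindexing by the permutation identifies
    the sums of w ln w for the two of them.  The shift by 1/n gives them total
    mass 2. *)
Lemma permutation_entropy_gap (R : realType) (n : nat) (p q : distr R 'I_n)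
    (w : 'I_n -> R) :
  Pi q p -> (forall i, w i = q i + n%:R^-1) ->
  dTV p q ^+ 2 / 2 <= \sum_i q i * ln (w i) - \sum_i p i * ln (w i).
Proof.
move=> [pi ppi] wE.
have n0 : (0 < n)%N.
  case: n => // in p q w pi ppi wE *.
  by have := pmf_sum1 p; rewrite big_ord0 => /eqP; rewrite eq_sym oner_eq0.
have V0 : 0 < n%:R^-1 :> R by rewrite invr_gt0 ltr0n.
pose v i := p i + n%:R^-1.
have w0 i : 0 < w i by rewrite wE ltr_wpDl ?pmf_ge0.
have v0 i : 0 < v i by rewrite ltr_wpDl ?pmf_ge0.
have sum2 (r : distr R 'I_n) : \sum_i (r i + n%:R^-1) = 2.
  rewrite big_split /= pmf_sum1 sumr_const card_ord -[_ *+ n]mulr_natr mulVf //.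
  by rewrite pnatr_eq0 -lt0n.
have wsum : \sum_i w i = 2.
  by rewrite -[RHS](sum2 q); apply: eq_bigr => i _; rewrite wE.
have := sqr_sum_norm_le_entropy v0 w0 (sum2 p) wsum.
have -> : \sum_i `|v i - w i| = 2 * dTV p q.
  rewrite dTVE mulVKf ?pnatr_eq0 //; apply: eq_bigr => i _.
  by rewrite wE /v opprD addrACA subrr addr0.
have -> : \sum_i v i * (ln (v i) - ln (w i))
   = \sum_i q i * ln (w i) - \sum_i p i * ln (w i).
  transitivity (\sum_i w i * ln (w i) - \sum_i v i * ln (w i)).
    rewrite [X in _ = X - _](reindex_inj (@perm_inj _ pi)) -sumrB.
    have w_pi i : w (pi i) = v i by rewrite wE /v ppi.
    by apply: eq_bigr => i _; rewrite w_pi mulrBr.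
  by rewrite -!sumrB; apply: eq_bigr => i _; rewrite {1}wE /v !mulrDl opprD addrACA subrr addr0.
by lra.
Qed.

(** * Chebyshev's inequality for independent samples *)

Definition iid_expect (R : realType) (T : finType) (s : nat) (p : distr R T)
    (F : {ffun 'I_s -> T} -> R) : R :=
  \sum_(x : {ffun 'I_s -> T}) (\prod_(i < s) p (x i)) * F x.

Lemma iid_expect_prod (R : realType) (T : finType) (s : nat) (p : distr R T)
    (h : 'I_s -> T -> R) :
  iid_expect p (fun x => \prod_i h i (x i)) = \prod_i \sum_y p y * h i y.
Proof.
rewrite bigA_distr_bigA /=.
by apply: eq_bigr => x _; rewrite big_split.
Qed.

Lemma iid_expect1 (R : realType) (T : finType) (s : nat) (p : distr R T) :
  iid_expect p (fun _ : {ffun 'I_s -> T} => 1) = 1.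
Proof.
transitivity (iid_expect p (fun x : {ffun 'I_s -> T} => \prod_(i < s) 1)).
  by apply: eq_bigr => x _; congr (_ * _); rewrite big1.
rewrite (iid_expect_prod p (fun _ _ => 1)) big1 // => i _.
by rewrite -[RHS](pmf_sum1 p); apply: eq_bigr => y _; rewrite mulr1.
Qed.

(** Centred functions of distinct samples are uncorrelated: the product of the
    two is written as a product over all samples, to which independence in the
    form of iid_expect_prod applies. *)
Lemma iid_expect_mul (R : realType) (T : finType) (s : nat) (p : distr R T)
    (g : T -> R) (i j : 'I_s) : \sum_y p y * g y = 0 ->
  iid_expect p (fun x : {ffun 'I_s -> T} => g (x i) * g (x j)) =
    if i == j then \sum_y p y * g y ^+ 2 else 0.
Proof.
move=> g0.
pose h k y := (if k == i then g y else 1) * (if k == j then g y else 1).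
transitivity (iid_expect p (fun x => \prod_k h k (x k))).
  apply: eq_bigr => x _; congr (_ * _).
  by rewrite big_split /= -!big_mkcond !big_pred1_eq.
rewrite iid_expect_prod (bigD1 i) //= /h eqxx; case: eqVneq => [<-|ij].
  rewrite [X in _ * X]big1 ?mulr1 // => k /negPf ki.
  by rewrite -[RHS](pmf_sum1 p); apply: eq_bigr => y _; rewrite ki !mulr1.
under eq_bigr do rewrite mulr1.
by rewrite g0 mul0r.
Qed.

Lemma iid_expect_sqr_sum (R : realType) (T : finType) (s : nat) (p : distr R T)
    (g : T -> R) : \sum_y p y * g y = 0 ->
  iid_expect p (fun x : {ffun 'I_s -> T} => (\sum_i g (x i)) ^+ 2) =
    s%:R * \sum_y p y * g y ^+ 2.
Proof.
move=> g0; transitivity (\sum_(i < s) \sum_(j < s)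
    iid_expect p (fun x : {ffun 'I_s -> T} => g (x i) * g (x j))).
  rewrite /iid_expect; under [RHS]eq_bigr do rewrite exchange_big.
  rewrite [RHS]exchange_big; apply: eq_bigr => x _ /=.
  rewrite expr2 mulr_suml mulr_sumr; apply: eq_bigr => i _.
  by rewrite !mulr_sumr.
rewrite mulr_natl -[s in RHS]card_ord -sumr_const; apply: eq_bigr => i _.
under eq_bigr do rewrite (iid_expect_mul _ _ g0).
by rewrite -big_mkcond (big_pred1 i) // => j; rewrite eq_sym.
Qed.

(** Chebyshev's inequality in the form that a tester needs: an answer given
    whenever the empirical mean of f is within t of its expectation is given
    with probability at least 1 - B^2 / (s t^2).  The sums are not divided by s,
    whence the deviation s t. *)
Lemma prob_output_ge_chebyshev (R : realType) (n s : nat) (A : algorithm R n s)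
    (p : distr R 'I_n) (b : bool) (f : 'I_n -> R) (B t : R) :
  (0 < s)%N -> 0 < t -> (forall i, `|f i| <= B) ->
  (forall x : {ffun 'I_s -> 'I_n},
     `|\sum_i f (x i) - s%:R * \sum_y p y * f y| < s%:R * t -> A x b = 1) ->
  1 - B ^+ 2 / (s%:R * t ^+ 2) <= prob_output A p b.
Proof.
move=> s0 t0 fB Ab; set mu := \sum_y _ in Ab *.
have sR : 0 < s%:R :> R by rewrite ltr0n.
pose g i := f i - mu.
have gE (x : {ffun 'I_s -> 'I_n}) : \sum_i g (x i) = \sum_i f (x i) - s%:R * mu.
  by rewrite sumrB sumr_const card_ord mulr_natl.
have g0 : \sum_y p y * g y = 0.
  under eq_bigr do rewrite mulrBr.
  by rewrite sumrB -mulr_suml pmf_sum1 mul1r subrr.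
have gB : \sum_y p y * g y ^+ 2 <= B ^+ 2.
  have -> : \sum_y p y * g y ^+ 2 = \sum_y p y * f y ^+ 2 - mu ^+ 2.
    transitivity (\sum_y (p y * f y ^+ 2
                           - (2 * mu * (p y * f y) - mu ^+ 2 * p y))).
      by apply: eq_bigr => y _; rewrite /g; ring.
    by rewrite !sumrB -!mulr_sumr pmf_sum1 -/mu; ring.
  rewrite (le_trans (_ : _ <= \sum_y p y * f y ^+ 2)) ?gerBl ?sqr_ge0 //.
  rewrite -[B ^+ 2]mul1r -(pmf_sum1 p) mulr_suml; apply: ler_sum => y _.
  rewrite ler_wpM2l ?pmf_ge0 // -real_normK ?num_real // lerXn2r ?nnegrE //.
  exact: le_trans (fB y).
have st0 : 0 < s%:R * t by exact: mulr_gt0.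
pose c := (s%:R * t) ^- 2.
(* Markov's inequality: A x b is at least 1 - c (sum of g)^2 for every x. *)
apply: (@le_trans _ _ (iid_expect p
    (fun x : {ffun 'I_s -> 'I_n} => 1 - c * (\sum_i g (x i)) ^+ 2))).
  have -> : iid_expect p
      (fun x : {ffun 'I_s -> 'I_n} => 1 - c * (\sum_i g (x i)) ^+ 2) =
      1 - c * (s%:R * \sum_y p y * g y ^+ 2).
    rewrite -[X in _ = X - _](iid_expect1 s p) -(iid_expect_sqr_sum s g0) mulr_sumr -sumrB.
    by apply: eq_bigr => x _; ring.
  have -> : B ^+ 2 / (s%:R * t ^+ 2) = c * (s%:R * B ^+ 2).
    by rewrite /c; field; rewrite !gt_eqF.
  by rewrite lerD2l lerN2 !ler_pM2l // invr_gt0 exprn_gt0.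
apply: ler_sum => x _; rewrite ler_wpM2l //.
  by apply: prodr_ge0 => i _; exact: pmf_ge0.
have c0 : 0 <= c by rewrite invr_ge0 exprn_ge0 // ltW.
rewrite gE; set dev := _ - s%:R * mu.
have [close|far] := ltP `|dev| (s%:R * t).
  by rewrite (Ab _ close) gerBl mulr_ge0 ?sqr_ge0.
apply: le_trans (pmf_ge0 (A x) b).
rewrite subr_le0 /c mulrC ler_pdivlMr ?exprn_gt0 // mul1r.
by rewrite -[leRHS]real_normK ?num_real // lerXn2r ?nnegrE // ltW.
Qed.

(** * The tester *)

Lemma point_mass_pmf (R : realType) (T : finType) (y : T) :
  is_pmf [ffun z => (z == y)%:R : R].
Proof.
apply/andP; split; first by apply/forallP => z; rewrite ffunE ler0n.
under eq_bigr do rewrite ffunE.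
by rewrite -natr_sum -big_mkcond sum1_card card1.
Qed.

Definition point_mass (R : realType) (T : finType) (y : T) : distr R T :=
  Distr (point_mass_pmf R y).

(** The threshold lies t below the mean under q and, under the gap hypothesis,
    at least t above the mean under p; each wrong answer therefore requires a
    deviation of at least t. *)
Lemma threshold_test_distinguishes (R : realType) (n s : nat) (p q : distr R 'I_n)
    (f : 'I_n -> R) (B t : R) :
  (0 < s)%N -> 0 < t -> (forall i, `|f i| <= B) ->
  3 * B ^+ 2 <= s%:R * t ^+ 2 ->
  let A : algorithm R n s := fun x =>
    point_mass R (s%:R * (\sum_y q y * f y - t) < \sum_i f (x i)) in
  2 / 3 <= prob_output A q yes /\
  (2 * t <= \sum_y q y * f y - \sum_y p y * f y -> 2 / 3 <= prob_output A p Defs.no).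
Proof.
move=> s0 t0 fB large A.
have sR : 0 < s%:R :> R by rewrite ltr0n.
have err : 2 / 3 <= 1 - B ^+ 2 / (s%:R * t ^+ 2).
  have : B ^+ 2 / (s%:R * t ^+ 2) <= 1 / 3.
    by rewrite ler_pdivrMr ?mulr_gt0 ?exprn_gt0 //; lra.
  by lra.
split=> [|gap]; apply: le_trans err _; apply: prob_output_ge_chebyshev fB _ => // x.
  rewrite ltr_norml => /andP[close _]; rewrite /A ffunE /yes.
  by rewrite (_ : _ < _ = true) //; lra.
rewrite ltr_norml => /andP[_ close]; rewrite /A ffunE /Defs.no.
rewrite (_ : _ < _ = false) //; apply/negbTE; rewrite -leNgt.
have := ler_wpM2l (ltW sR) gap; lra.
Qed.

Theorem theorem3p1 (R : realType) :
  exists C : R, 0 < C /\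
    forall (n : nat) (q : distr R 'I_n) (eps : R),
      (1 <= n)%N -> 0 < eps -> eps <= 1 ->
      exists (s : nat) (A : algorithm R n s),
        s%:R <= C * (log2 n%:R ^+ 2 / eps ^+ 4) /\
        distinguishes A (Pi q) (fun p => p = q) (fun p => dTV p q > eps).
Proof.
(* 48 comes from the error bound with t = eps^2 / 4; rounding the number of
   samples up to an integer adds at most 1 <= (log2 n)^2 / eps^4. *)
exists 49; split=> // n q eps n1 eps0 eps1.
have [n_le1|n_gt1] := leqP n 1.
  (* As log2 1 = 0, no sample is allowed; the only distribution is q. *)
  have dTV0 (p : distr R 'I_n) : dTV p q = 0.
    have n_eq1 : n = 1%N by apply/eqP; rewrite eqn_leq n_le1 n1.
    case: _ / (esym n_eq1) in q p *.
    rewrite dTVE big_ord1.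
    have := pmf_sum1 p; have := pmf_sum1 q; rewrite !big_ord1 => -> ->.
    by rewrite subrr normr0 mulr0.
  exists 0%N, (fun=> point_mass R yes); split.
    by rewrite mulr_ge0 // mulr_ge0 ?sqr_ge0 ?invr_ge0 ?exprn_ge0 ?ltW.
  move=> p _; split=> [_|]; last by rewrite dTV0 ltNge ltW.
  rewrite (_ : prob_output _ _ _ = 1); first by lra.
  by rewrite -[RHS](iid_expect1 0 p); apply: eq_bigr => x _; rewrite ffunE eqxx.
have nR : 1 < n%:R :> R by rewrite ltr1n.
have n0 : 0 < n%:R :> R by rewrite ltr0n.
pose f (i : 'I_n) := ln (q i + n%:R^-1).
(* 1/n <= w <= 1 + 1/n <= n; the last inequality uses n >= 2. *)
have fB i : `|f i| <= ln n%:R.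
  have V0 : 0 < n%:R^-1 :> R by rewrite invr_gt0.
  have q0 := pmf_ge0 q i.
  have q1 : q i <= 1.
    rewrite -(pmf_sum1 q) (bigD1 i) //= lerDl; apply: sumr_ge0 => *; exact: pmf_ge0.
  rewrite ler_norml -lnV ?posrE // !ler_ln ?posrE ?ltr_wpDl // lerDr q0 /=.
  have V1 : n%:R^-1 <= 1 :> R by rewrite invf_le1 // ltW.
  by have : 2 <= n%:R :> R; [rewrite ler_nat | lra].
pose X : R := 48 * ln n%:R ^+ 2 / eps ^+ 4.
have e4 : 0 < eps ^+ 4 by rewrite exprn_gt0.
have X0 : 0 <= X by rewrite divr_ge0 ?(ltW e4) // mulr_ge0 // sqr_ge0.
have /andP[sX Xs] := truncn_itv X0.
set s := (Num.trunc X).+1 in Xs.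
have [t0 s0] : 0 < eps ^+ 2 / 4 /\ (0 < s)%N by rewrite divr_gt0 ?exprn_gt0.
have large : 3 * ln n%:R ^+ 2 <= s%:R * (eps ^+ 2 / 4) ^+ 2.
  move/ltW: Xs; rewrite /X ler_pdivrMr //.
  by lra.
have test p := threshold_test_distinguishes p q s0 t0 fB large.
exists s; eexists; split; last first.
  move=> p pq; split=> [->|far]; first exact: (test q).1.
  apply: (test p).2.
  apply: le_trans (permutation_entropy_gap pq (fun=> erefl)).
  have : eps ^+ 2 <= dTV p q ^+ 2 by rewrite lerXn2r ?nnegrE ?ltW // (lt_trans eps0).
  by lra.
have ln2_0 : 0 < ln 2 :> R by rewrite ln_gt0 // ltr1n.
have ln2_1 : ln 2 <= 1 :> R by have := @le_ln1Dx R 1; rewrite -[1 + 1]/2; apply; lra.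
have log1 : 1 <= log2 n%:R :> R.
  by rewrite /log2 ler_pdivlMr // mul1r ler_ln ?posrE // ler_nat.
have lnlog : ln n%:R <= log2 n%:R :> R.
  by rewrite /log2 ler_pdivlMr // ler_piMr // ln_ge0 // ltW.
have sq1 : 1 <= log2 n%:R ^+ 2 / eps ^+ 4 :> R.
  by rewrite ler_pdivlMr // mul1r (le_trans (exprn_ile1 _ (ltW eps0) eps1)) ?exprn_ege1.
have : X <= 48 * (log2 n%:R ^+ 2 / eps ^+ 4).
  rewrite /X -mulrA ler_wpM2l // ler_wpM2r ?invr_ge0 ?(ltW e4) //.
  have ln0 : 0 <= ln n%:R :> R by rewrite ln_ge0 // ltW.
  by rewrite lerXn2r ?nnegrE ?ln0 ?(le_trans ln0).
by rewrite /s -natr1; lra.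
Qed.
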